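(* Let $n$ and $k$ be positive integers and let $\mathcal I\subseteq 2^{\binom{[n]}{2}}$ be a nontrivial increasing graph property. Then, for every $H\in\mathcal I$, \[ p_k(\mathcal I)\le r_k(H). \] Consequently, $p_k(\mathcal I)\le\min_{H\in\mathcal I} r_k(H)$.
   Context: Graphs are finite and simple. For a finite set $X$ and $p\in[0,1]$, $\mu_p$ is the product measure on $2^X$: $\mu_p(\{A\})=p^{|A|}(1-p)^{|X\setminus A|}$. A family $\mathcal F\subseteq 2^X$ is nontrivial if $\mathcal F\ne\emptyset,2^X$; increasing if closed under supersets; decreasing if closed under subsets. For a decreasing family $\mathcal D\subseteq 2^X$, $\mathcal D_{(k)}:=\{D_1\cup\cdots\cup D_k: D_i\in\mathcal D\}$. For an increasing family $\mathcal I\subseteq 2^X$, the $k$-threshold $p_k(\mathcal I)$ is the infimum of the set of $p\in[0,1]$ such that for every decreasing $\mathcal D\subseteq 2^X$ with $\mu_p(\mathcal D)\ge 1-\frac1{2k}$ we have $\mathcal D_{(k)}\cap\mathcal I\neq\emptyset$. For a nontrivial increasing family, the threshold $p_c(\mathcal I)$ is the unique $p$ with $\mu_p(\mathcal I)=1/2$. Take $X=\binom{[n]}2$ and identify each element of $2^{\binom{[n]}2}$ with a labeled graph on vertex set $[n]$. A family $\mathcal G\subseteq 2^{\binom{[n]}{2}}$ is a graph property if it is invariant under relabeling, i.e. under the action of permutations of $[n]$ on graphs. For a graph $J$ on at most $n$ vertices, $\mathcal I_J\subseteq 2^{\binom{[n]}2}$ is the family of all graphs on $[n]$ having a subgraph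 isomorphic to $J$, and $p_c(J):=p_c(\mathcal I_J)$; by convention $p_c(J)=0$ if $J$ has no edges. A $k$-decomposition of a graph $H$ is a sequence $(H_1,\dots,H_k)$ of subgraphs of $H$ with $E(H_1)\cup\cdots\cup E(H_k)=E(H)$ (subgraphs are obtained by deleting vertices and/or edges; isolated vertices of $H$ need not appear in any $H_i$). Define $r_k(H)$ to be the minimum of $\max_{i\in[k]}p_c(H_i)$ over all $k$-decompositions $(H_1,\dots,H_k)$ of $H$. *)

(* Defs.v *)
From mathcomp Require Import all_boot all_order all_fingroup all_algebra.
From mathcomp Require Import boolp classical_sets reals.
Set Implicit Arguments.
Unset Strict Implicit.
Unset Printing Implicit Defensive.
Import Order.TTheory GRing.Theory Num.Theory.
Local Open Scope ring_scope.

(* [xget 0 A] is an element of A if there is one, and 0 otherwise. *)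
Definition minimum (R : realType) (A : set R) : R :=
  xget 0 [set m | A m /\ lbound A m]%classic.

Lemma minimumP (R : realType) (T : finType) (P : pred T) (F : T -> R) (x0 : T) :
  P x0 ->
  let m := minimum [set y | exists2 x, P x & y = F x]%classic in
  (exists2 x, P x & m = F x) /\ (forall x, P x -> m <= F x).
Proof.
move=> Px0 m; rewrite /m /minimum.
case: (arg_minP F Px0) => x Px minx.
case: xgetP => [y _ [Fy lby]|/(_ (F x)) []].
  by split=> // z Pz; apply: lby; exists z.
by split; [exists x | move=> _ [z Pz ->]; apply: minx].
Qed.

Section Families.
Variable X : finType.
Implicit Types F I D : {set {set X}}.

Definition mu (R : realType) (p : R) F : R :=
  \sum_(A in F) p ^+ #|A| * (1 - p) ^+ #|~: A|.

Definition nontrivial F : Prop := F <> finset.set0 /\ F <> [set: {set X}]%SET.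

Definition increasing F : Prop :=
  forall A B : {set X}, A \subset B -> A \in F -> B \in F.

Definition decreasing F : Prop :=
  forall A B : {set X}, A \subset B -> B \in F -> A \in F.

Definition k_unions (k : nat) D : {set {set X}} :=
  [set (\bigcup_(i < k) d i)%SET | d : {ffun 'I_k -> {set X}} in ffun_on (mem D)]%SET.

Definition k_threshold (R : realType) (k : nat) I : R :=
  inf [set p : R | 0 <= p <= 1 /\
    forall D, decreasing D -> 1 - (2 * k%:R)^-1 <= mu p D ->
      (k_unions k D :&: I)%SET <> finset.set0]%classic.

(* For nontrivial increasing I, exactly one p satisfies the condition. *)
Definition threshold (R : realType) I : R :=
  xget 0 [set p : R | 0 <= p <= 1 /\ mu p I = 1 / 2]%classic.

End Families.

Definition edge (T : finType) := {e : {set T} | #|e| == 2}.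

(* A graph whose vertex set is a subset of T. *)
Definition sgraph (T : finType) :=
  {G : {set T} * {set edge T} | [forall e in G.2, val e \subset G.1]}.

Definition verts (T : finType) (G : sgraph T) : {set T} := (val G).1.
Definition edges (T : finType) (G : sgraph T) : {set edge T} := (val G).2.

Fact labeled_subproof (T : finType) (E : {set edge T}) :
  [forall e in E, val e \subset [set: T]%SET].
Proof. by apply/forall_inP=> e _; apply: finset.subsetT. Qed.

(* The identification of 2^(T choose 2) with the graphs on the whole of T. *)
Definition labeled (T : finType) (E : {set edge T}) : sgraph T :=
  exist (fun G : {set T} * {set edge T} =>
           is_true [forall e in G.2, val e \subset G.1])
    ([set: T]%SET, E) (labeled_subproof E).

Definition subgraph (T : finType) (G H : sgraph T) : bool :=
  (verts G \subset verts H) && (edges G \subset edges H).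

Definition isomorphism (T U : finType) (G : sgraph T) (H : sgraph U)
    (f : T -> U) : Prop :=
  [/\ {in verts G &, injective f},
      (f @: verts G)%SET = verts H
    & [set (f @: val e)%SET | e : edge T in edges G]%SET =
      [set val e | e : edge U in edges H]%SET].

Definition relabel (T : finType) (s : {perm T}) (E : {set edge T}) :
    {set edge T} :=
  [set e : edge T | [exists e0 in E, val e == (s @: val e0)%SET]]%SET.

Definition graph_property (T : finType) (I : {set {set edge T}}) : Prop :=
  forall (s : {perm T}) (E : {set edge T}), (relabel s E \in I) = (E \in I).

Section Subgraphs.
Variable n : nat.

Definition containing (T : finType) (J : sgraph T) : {set {set edge 'I_n}} :=
  [set E | `[< exists (J' : sgraph 'I_n) (f : T -> 'I_n),
                 subgraph J' (labeled E) /\ isomorphism J J' f >]]%SET.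

(* Meant for J with at most n vertices. *)
Definition graph_threshold (R : realType) (T : finType) (J : sgraph T) : R :=
  if edges J == finset.set0 then 0 else threshold R (containing J).

Definition decomposition (k : nat) (H : sgraph 'I_n)
    (d : {ffun 'I_k -> sgraph 'I_n}) : bool :=
  [forall i, subgraph (d i) H] && ((\bigcup_(i < k) edges (d i))%SET == edges H).

(* Thresholds are nonnegative, so for k > 0 the big operator is the maximum. *)
Definition r_ (R : realType) (k : nat) (H : sgraph 'I_n) : R :=
  minimum [set r : R | exists2 d : {ffun 'I_k -> sgraph 'I_n},
    decomposition H d & r = \big[Num.max/0]_(i < k) graph_threshold R (d i)]%classic.

End Subgraphs.

(* Main.v *)
(** Let [p] exceed the thresholds of all parts [H_i], and let [D] be decreasing
    of measure at least [1 - 1/(2k)].  A random graph contains a copy of [H_i]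
    with probability more than 1/2, and given that, by symmetry, a random such
    copy is a uniformly random relabeling of [H_i]; if the copy is outside [D],
    so is the random graph.  Hence a random relabeling of [H_i] is outside [D]
    with probability less than [1/k], and by the union bound one relabeling puts
    all the parts in [D] at once: their union, a relabeling of [H], is in [I].
    The strict inequality [p > p_c(H_i)] is needed for the union bound, and it
    suffices because [p_k] is an infimum and all [p_c(H_i)] are less than 1. *)

Require Import Defs.
From mathcomp Require Import all_boot all_order all_fingroup all_algebra.
From mathcomp Require Import boolp classical_sets reals.
From mathcomp Require Import ring lra.
Set Implicit Arguments.
Unset Strict Implicit.
Unset Printing Implicit Defensive.
Import Order.TTheory GRing.Theory Num.Theory.
Local Open Scope ring_scope.

(** * Product measure and thresholds of increasing families *)

Section ProductMeasure.
Variables (R : realType) (X : finType).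
Implicit Types (p q s : R) (A B C : {set X}) (F D I : {set {set X}}).

Definition weight p A : R := p ^+ #|A| * (1 - p) ^+ #|~: A|.

Lemma weightE p A : weight p A = \prod_x (if x \in A then p else 1 - p).
Proof.
rewrite /weight (bigID (mem A)) /=; congr (_ * _).
  by rewrite -prodr_const; apply: eq_bigr => x ->.
rewrite -prodr_const; apply: eq_big => x; first by rewrite inE.
by rewrite inE => /negbTE ->.
Qed.

Lemma weight_ge0 p A : 0 <= p <= 1 -> 0 <= weight p A.
Proof. by case/andP=> p0 p1; rewrite mulr_ge0 // exprn_ge0 // subr_ge0. Qed.

Lemma mu_setT p : mu p [set: {set X}]%SET = 1.
Proof.
transitivity (\prod_(x : X) (p + (1 - p))).
  by rewrite bigA_distr; apply: eq_big => A; rewrite ?inE // => _; rewrite -weightE.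
by rewrite big1 // => x _; rewrite addrC subrK.
Qed.

Lemma mu_setC p F : mu p (~: F)%SET = 1 - mu p F.
Proof.
apply/eqP; rewrite eq_sym subr_eq addrC -(mu_setT p) /mu (bigID (mem F)) /=.
by apply/eqP; congr (_ + _); apply: eq_bigl => A; rewrite !inE.
Qed.

Lemma prod_indicator (P : pred X) :
  \prod_x (P x)%:R = [forall x, P x]%:R :> R.
Proof.
case: (boolP [forall x, P x]) => [/forallP Px|].
  by rewrite big1 // => x _; rewrite Px.
by case/forallPn=> x /negbTE nPx; rewrite (bigD1 x) //= nPx mul0r.
Qed.

(* The union of independent random sets of densities [p] and [s] is a random
   set of density [1 - (1 - p)(1 - s)]. *)
Lemma weight_union p s C :
  weight (p + (1 - p) * s) C =
  \sum_A \sum_B weight p A * weight s B * (A :|: B == C)%:R.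
Proof.
(* The booleans record whether [x] lies in the first and in the second random set. Expanding the
   product over [x], once for each boolean, turns these choices into the sets [A] and [B]. *)
pose g (a b : bool) x : R := (if a then p else 1 - p) *
  (if b then s else 1 - s) * (a || b == (x \in C))%:R.
transitivity (\prod_x ((g true true x + g true false x) +
                       (g false true x + g false false x))).
  rewrite weightE; apply: eq_bigr => x _; rewrite /g.
  by case: (x \in C) => /=; ring.
rewrite bigA_distr; apply: eq_bigr => A _.
transitivity (\prod_x (g (x \in A) true x + g (x \in A) false x)).
  by apply: eq_bigr => x _; case: (x \in A).
rewrite bigA_distr; apply: eq_bigr => B _.
rewrite !weightE -big_split /=.
have -> : (A :|: B == C) = [forall x, (x \in A) || (x \in B) == (x \in C)].
  apply/eqP/forallP => [<- x|eqC]; first by rewrite inE.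
  by apply/setP=> x; rewrite inE; apply/eqP.
rewrite -prod_indicator -big_split /=; apply: eq_bigr => x _.
by rewrite /g; case: (x \in B).
Qed.

Lemma nontrivial_increasing I :
  nontrivial I -> increasing I -> finset.set0 \notin I /\ [set: X]%SET \in I.
Proof.
case=> I0 IT incr; split.
  apply/negP=> I_0; apply: IT; apply/setP=> A; rewrite inE.
  by apply: incr I_0; apply: finset.sub0set.
have /set0Pn[A AI] : I != finset.set0 by apply/eqP.
by apply: incr AI; apply: finset.subsetT.
Qed.

(** Coupling: a random set of density [q] is the union of one of density [p] with an independent
    one, and enlarging a set cannot leave [I]. *)
Lemma mu_strict_mono p q I : increasing I -> finset.set0 \notin I ->
  [set: X]%SET \in I -> 0 <= p -> p < q -> q <= 1 -> mu p I < mu q I.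
Proof.
move=> incr I0 IT p0 pq q1.
have p1 : 0 < 1 - p by lra.
(* Solves [1 - q = (1 - p) * (1 - s)]. *)
pose s := (q - p) / (1 - p).
have s0 : 0 < s by rewrite divr_gt0 // subr_gt0.
have s1 : s <= 1 by rewrite ler_pdivrMr // mul1r; lra.
have -> : q = p + (1 - p) * s by rewrite /s; field; lra.
have muq : mu (p + (1 - p) * s) I =
    \sum_A \sum_B weight p A * weight s B * ((A :|: B)%SET \in I)%:R.
  transitivity (\sum_(C in I) weight (p + (1 - p) * s) C); first by [].
  rewrite (eq_bigr _ (fun C _ => weight_union p s C)) exchange_big /=.
  apply: eq_bigr => A _; rewrite exchange_big /=; apply: eq_bigr => B _.
  rewrite -mulr_sumr; congr (_ * _).
  rewrite big_mkcond (bigD1 (A :|: B)%SET) //= eqxx big1 ?addr0.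
    by case: ifP.
  by move=> C; rewrite eq_sym => /negbTE->; case: ifP.
have mup : mu p I = \sum_A \sum_B weight p A * weight s B * (A \in I)%:R.
  transitivity (\sum_(A in I) weight p A); first by [].
  rewrite big_mkcond /=; apply: eq_bigr => A _.
  rewrite -mulr_suml -mulr_sumr.
  have -> : \sum_B weight s B = 1.
    by rewrite -(mu_setT s); apply: eq_bigl => B; rewrite inE.
  by rewrite mulr1; case: ifP; rewrite ?mulr1 ?mulr0.
have ws A : 0 <= weight s A by rewrite weight_ge0 // (ltW s0).
have wp A : 0 <= weight p A by rewrite weight_ge0 // p0 /=; lra.
have le_term A B : weight p A * weight s B * (A \in I)%:R <=
    weight p A * weight s B * ((A :|: B)%SET \in I)%:R.
  apply: ler_wpM2l; first exact: mulr_ge0.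
  by rewrite ler_nat; case: (boolP (A \in I)) => // /(incr _ _ (finset.subsetUl A B)) ->.
(* Strictness comes from the pair of the empty set and the full set: its weight is positive since
   [p < 1] and [0 < s], and only the union lies in [I]. *)
rewrite muq mup (bigD1 finset.set0) //= [ltRHS](bigD1 finset.set0) //=.
apply: ltr_leD; last by apply: ler_sum => A _; apply: ler_sum.
rewrite (bigD1 [set: X]%SET) //= [ltRHS](bigD1 [set: X]%SET) //=.
apply: ltr_leD; last by apply: ler_sum.
rewrite (negbTE I0) finset.setUT IT mulr0 mulr1 mulr_gt0 //.
  by rewrite /weight cards0 expr0 mul1r exprn_gt0.
by rewrite /weight finset.setCT cards0 expr0 mulr1 exprn_gt0.
Qed.

(** As a function of [p], the measure of [I] is a polynomial going from 0 at 0 to 1 at 1, so it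
    takes the value 1/2, and not at 1. *)
Lemma threshold_spec I : increasing I -> finset.set0 \notin I ->
  [set: X]%SET \in I ->
  [/\ 0 <= threshold R I, threshold R I < 1 & mu (threshold R I) I = 1 / 2].
Proof.
move=> incr I0 IT.
pose P : {poly R} := \sum_(A in I) 'X ^+ #|A| * (1 - 'X) ^+ #|~: A|.
have PE p : P.[p] = mu p I.
  rewrite /P horner_sum; apply: eq_bigr => A _.
  by rewrite !hornerE.
have mu0 : mu 0 I = 0 :> R.
  rewrite /mu big1 // => A AI; rewrite expr0n cards_eq0.
  by case: eqP => [A0|]; rewrite ?mul0r //; rewrite -A0 AI in I0.
have mu1 : mu 1 I = 1 :> R.
  rewrite /mu (bigD1 [set: X]%SET) //= finset.setCT cards0 expr0 mulr1 expr1n.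
  rewrite big1 ?addr0 // => A /andP[_ AT]; rewrite subrr expr0n cards_eq0.
  rewrite -[X in _ == X]finset.setCT (inj_eq (@finset.setC_inj _)).
  by rewrite (negbTE AT) mulr0.
have [|x /andP[x0 x1]] := @poly_ivt R (P - (1 / 2)%:P) 0 1 ler01.
  by rewrite !hornerE !PE mu0 mu1; apply/andP; split; lra.
move=> /rootP rx; have mux : mu x I = 1 / 2.
  by apply/eqP; rewrite -subr_eq0 -PE -rx !hornerE.
rewrite /threshold; case: xgetP => [t _ [/andP[t0 t1] mut]|/(_ x) []].
  split=> //; rewrite lt_neqAle t1 andbT; apply/eqP=> t1'.
  by move: mut; rewrite t1' mu1; lra.
by rewrite /= x0 x1.
Qed.

End ProductMeasure.

(** * Action of vertex permutations on edge sets *)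

Section Relabeling.
Variable T : finType.
Implicit Types (s t : {perm T}) (E : {set edge T}) (e : edge T).

Lemma injection_extends_perm (A : {set T}) (f : T -> T) :
  {in A &, injective f} -> exists s : {perm T}, {in A, s =1 f}.
Proof.
move=> injf.
suff ext (r : seq T) : {subset r <= A} -> exists s : {perm T}, {in r, s =1 f}.
  have [|s sf] := ext (enum A); first by move=> x; rewrite mem_enum.
  by exists s => x xA; apply: sf; rewrite mem_enum.
elim: r => [|x r IHr] rA; first by exists 1%g.
have xA : x \in A by apply: rA; rewrite mem_head.
have [|s sf] := IHr; first by move=> y yr; apply: rA; rewrite inE yr orbT.
(* The transposition corrects the image of [x]. It fixes the images of the earlier points, which
   differ from [s x] and, by injectivity of [f], from [f x]. *)
exists (s * tperm (s x) (f x))%g => y; rewrite inE permM.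
have [-> _|neq_yx /= yr] := eqVneq y x; first by rewrite tpermL.
have yA : y \in A by apply: rA; rewrite inE yr orbT.
rewrite tpermD; first exact: sf.
  by rewrite (inj_eq perm_inj) eq_sym.
by rewrite sf //; apply: contra neq_yx => /eqP /(injf _ _ xA yA) ->.
Qed.

Fact edge_image_subproof s e : #|s @: val e| == 2.
Proof. by rewrite card_imset; [exact: valP e | exact: perm_inj]. Qed.

Definition edge_image s e : edge T :=
  Sub (s @: val e)%SET (edge_image_subproof s e).

Lemma edge_image_inj s : injective (edge_image s).
Proof.
move=> e1 e2 /(congr1 val) /= /imset_inj eq12.
by apply: val_inj; apply: eq12; apply: perm_inj.
Qed.

Lemma relabelE s E : relabel s E = (edge_image s @: E)%SET.
Proof.
apply/setP=> e; rewrite inE; apply/exists_inP/imsetP => -[e0 e0E].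
  by move/eqP=> eE; exists e0 => //; apply: val_inj.
by move->; exists e0.
Qed.

Lemma relabelM s t E : relabel (s * t)%g E = relabel t (relabel s E).
Proof.
rewrite !relabelE -imset_comp; apply: eq_imset => e /=.
apply: val_inj; rewrite /= -imset_comp; apply: eq_imset => x /=.
by rewrite permM.
Qed.

Lemma relabel_inj s : injective (relabel s).
Proof.
by move=> E1 E2; rewrite !relabelE => /imset_inj; apply; apply: edge_image_inj.
Qed.

Lemma relabelS s E1 E2 : E1 \subset E2 -> relabel s E1 \subset relabel s E2.
Proof. by rewrite !relabelE; apply: imsetS. Qed.

Lemma relabel_bigcup (k : nat) (E : 'I_k -> {set edge T}) s :
  relabel s (\bigcup_(i < k) E i)%SET = (\bigcup_(i < k) relabel s (E i))%SET.
Proof.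
rewrite relabelE (big_morph _ (imsetU _) (imset0 _)).
by apply: eq_bigr => i _; rewrite relabelE.
Qed.

Lemma weight_relabel (R : realType) (p : R) s E :
  weight p (relabel s E) = weight p E.
Proof.
have eq_card : #|relabel s E| = #|E|.
  by rewrite relabelE card_imset //; apply: edge_image_inj.
have eq_cardC : #|~: relabel s E| = #|~: E|.
  by rewrite [LHS]cardsCs [RHS]cardsCs !finset.setCK eq_card.
by rewrite /weight eq_card eq_cardC.
Qed.

(** Double counting: each fixed permutation preserves weights, hence contributes exactly
    [mu p F]. *)
Lemma sum_mu_relabel (R : realType) (p : R) (F : {set {set edge T}}) :
  \sum_E weight p E * #|[set s : {perm T} | relabel s E \in F]|%:R =
  #|{perm T}|%:R * mu p F.
Proof.
transitivity (\sum_E \sum_(s : {perm T}) weight p E * (relabel s E \in F)%:R).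
  apply: eq_bigr => E _; rewrite -mulr_sumr -natr_sum; congr (_ * _%:R).
  by rewrite -sum1_card big_mkcond; apply: eq_bigr => s _; rewrite inE; case: ifP.
rewrite exchange_big /= -[#|_|]sum1_card natr_sum mulr_suml.
apply: eq_bigr => s _; rewrite mul1r.
rewrite /mu [RHS]big_mkcond [RHS](reindex_inj (@relabel_inj s)) /=.
apply: eq_bigr => E _; rewrite -/(weight p (relabel s E)) weight_relabel.
by case: ifP; rewrite ?mulr1 ?mulr0.
Qed.

End Relabeling.

(** * Copies of a graph and the union bound over a decomposition *)

Section Copies.
Variable n : nat.
Implicit Types (J : sgraph 'I_n) (E : {set edge 'I_n}).

(** The injection defining a copy extends to a permutation that agrees with it on [verts J], hence
    on all edges of [J]. Copies thus come from a group, over which one can average. *)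
Lemma containing_relabel J E :
  E \in containing n J -> exists t : {perm 'I_n}, relabel t (edges J) \subset E.
Proof.
rewrite inE => /asboolP[J' [f [/andP[_ J'E] [injf _ edgesJ']]]].
have [t tf] := injection_extends_perm injf.
exists t; apply: (fintype.subset_trans _ J'E); apply/fintype.subsetP=> e.
rewrite inE => /exists_inP[e0 e0J /eqP eE].
have e0V : val e0 \subset verts J by have /forall_inP := valP J; apply.
have : val e \in [set val e | e : edge 'I_n in edges J']%SET.
  rewrite -edgesJ'; apply/imsetP; exists e0 => //; rewrite eE.
  by apply: eq_in_imset => x xe0; apply: tf; apply: (fintype.subsetP e0V).
by case/imsetP=> e' e'J' /val_inj ->.
Qed.

Lemma containing_increasing J : increasing (containing n J).
Proof.
move=> E1 E2 E12; rewrite !inE => -[J' [f [/andP[J'V J'E] iso]]].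
exists J'; exists f; split=> //; apply/andP; split=> //.
exact: fintype.subset_trans J'E E12.
Qed.

Lemma isomorphism_id J : isomorphism J J id.
Proof.
split=> //; first exact: imset_id.
by apply: eq_imset => e; rewrite imset_id.
Qed.

Lemma edges_in_containing J : edges J \in containing n J.
Proof.
rewrite inE; apply/asboolP; exists J; exists id; split; last exact: isomorphism_id.
by rewrite /subgraph /= finset.subsetT fintype.subxx.
Qed.

Lemma set0_containing J : finset.set0 \in containing n J -> edges J = finset.set0.
Proof.
move/containing_relabel=> [t]; rewrite finset.subset0 relabelE imset_eq0.
by move/eqP.
Qed.

Lemma graph_threshold_lt1 (R : realType) J : graph_threshold n R J < 1.
Proof.
rewrite /graph_threshold; case: eqP => [_|J0]; first exact: ltr01.
have [//||//] := @threshold_spec R _ (containing n J) (@containing_increasing J).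
  by apply/negP => /set0_containing.
apply: containing_increasing (edges_in_containing J).
exact: finset.subsetT.
Qed.

Lemma mu_containing_gt_half (R : realType) J (p : R) :
  graph_threshold n R J < p -> p <= 1 -> 1 / 2 < mu p (containing n J).
Proof.
rewrite /graph_threshold; case: eqP => [J0 _ _|J0 ltp p1].
  (* Without edges the threshold is 0 by convention, but every graph contains [J], so the measure is
     1. *)
  have -> : containing n J = [set: {set edge 'I_n}]%SET.
    apply/setP=> E; rewrite finset.in_setT.
    apply: containing_increasing (edges_in_containing J).
    by rewrite J0 finset.sub0set.
  by rewrite mu_setT; lra.
have I0 : finset.set0 \notin containing n J by apply/negP => /set0_containing.
have IT : [set: edge 'I_n]%SET \in containing n J.
  apply: containing_increasing (edges_in_containing J).
  exact: finset.subsetT.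
have incr := @containing_increasing J.
have [t0 _ <-] := @threshold_spec R _ _ incr I0 IT.
exact: mu_strict_mono.
Qed.

(* If [G] contains [relabel t (edges J)], then [relabel s G] can only lie in [D]
   when [relabel (t * s) (edges J)] does. Averaging over [s], which preserves
   [mu p], bounds the fraction of copies of [J] outside [D]. *)
Lemma copies_outside (R : realType) (p : R) J (D : {set {set edge 'I_n}}) :
  0 <= p <= 1 -> decreasing D ->
  mu p (containing n J) *
    #|[set s : {perm 'I_n} | relabel s (edges J) \notin D]|%:R <=
  #|{perm 'I_n}|%:R * (1 - mu p D).
Proof.
move=> p01 decr; rewrite -mu_setC -sum_mu_relabel mulr_suml big_mkcond /=.
apply: ler_sum => E _; case: ifP => [EJ|_]; last first.
  by rewrite mulr_ge0 ?ler0n ?weight_ge0.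
apply: ler_wpM2l; first exact: weight_ge0.
have [t tE] := containing_relabel EJ; rewrite ler_nat.
(* Translation by the inverse of [t] maps the permutations sending [J] outside [D] injectively to
   permutations sending [E] outside [D]. *)
rewrite -(card_imset _ (@mulgI _ (t^-1)%g)); apply/subset_leq_card.
apply/fintype.subsetP=> _ /imsetP[s sJ ->]; rewrite inE finset.in_setC.
rewrite inE in sJ; apply: contra sJ; apply: decr.
rewrite -{1}[s](mulKVg t) relabelM; exact: relabelS.
Qed.

Lemma common_relabeling (R : realType) (k : nat) (p : R)
    (d : 'I_k -> sgraph 'I_n) (D : {set {set edge 'I_n}}) :
  (0 < k)%N -> 0 <= p <= 1 -> (forall i, graph_threshold n R (d i) < p) ->
  decreasing D -> 1 - (2 * k%:R)^-1 <= mu p D ->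
  exists s : {perm 'I_n}, forall i, relabel s (edges (d i)) \in D.
Proof.
move=> k0 p01 ltp decr muD; have /andP[_ p1] := p01.
pose bad i := [set s : {perm 'I_n} | relabel s (edges (d i)) \notin D]%SET.
pose N := #|{perm 'I_n}|.
have N0 : 0 < N%:R :> R by rewrite ltr0n; apply/card_gt0P; exists 1%g.
have kR0 : 0 < k%:R :> R by rewrite ltr0n.
have bad_lt i : #|bad i|%:R < N%:R / k%:R :> R.
  (* Multiplying the bound [1 / 2 < mu p _] by the number of bad permutations keeps it strict only
     if that number is positive. *)
  have [->|b0] := eqVneq #|bad i| 0%N; first by rewrite divr_gt0.
  have bR0 : 0 < #|bad i|%:R :> R by rewrite ltr0n lt0n.
  have half := mu_containing_gt_half (ltp i) p1.
  have le_bad := copies_outside (d i) p01 decr.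
  have muDC : N%:R * (1 - mu p D) <= N%:R / (2 * k%:R).
    by apply: ler_wpM2l; [exact: ltW | rewrite lerBlDl -lerBlDr].
  have lt_bad : 1 / 2 * #|bad i|%:R < N%:R / (2 * k%:R) :> R.
    apply: lt_le_trans (le_trans le_bad muDC).
    by rewrite ltr_pM2r.
  have -> : N%:R / k%:R = 2 * (N%:R / (2 * k%:R)) :> R.
    by field; exact: lt0r_neq0.
  by rewrite -ltr_pdivrMl // -div1r.
have : (#|(\bigcup_(i < k) bad i)%SET| < N)%N.
  apply: leq_ltn_trans (_ : \sum_(i < k) #|bad i| < N)%N.
    elim/big_rec2: _ => [|i y S _ le_S]; first by rewrite cards0.
    by apply: leq_trans (leq_card_setU _ _) _; rewrite leq_add2l.
  rewrite -(ltr_nat R) natr_sum.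
  apply: lt_le_trans (_ : \sum_(i < k) N%:R / k%:R <= _).
    by apply: ltr_sum => //; apply/hasP; exists (Ordinal k0); rewrite ?mem_index_enum.
  by rewrite sumr_const card_ord -[_ *+ k]mulr_natr divfK // lt0r_neq0.
rewrite ltnNge; apply: contraNP => no_s; rewrite /N -cardsT.
apply/subset_leq_card/fintype.subsetP=> s _; apply/bigcupP.
apply: contrapT => no_i; apply: no_s; exists s => i.
by apply: contrapT => /negP sD; apply: no_i; exists i; rewrite // inE.
Qed.

Lemma k_threshold_le_decomposition (R : realType) (k : nat)
    (I : {set {set edge 'I_n}}) (H : {set edge 'I_n})
    (d : {ffun 'I_k -> sgraph 'I_n}) :
  (0 < k)%N -> graph_property I -> H \in I -> decomposition (labeled H) d ->
  k_threshold R k I <= \big[Num.max/0]_(i < k) graph_threshold n R (d i).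
Proof.
move=> k0 Iprop HI /andP[_ /eqP dH].
set q := bigop _ _ _.
have q0 : 0 <= q by apply: bigmax_ge_id.
have q1 : q < 1 by apply: bigmax_lt => // i _; apply: graph_threshold_lt1.
have le_threshold p : q < p -> p <= 1 -> k_threshold R k I <= p.
  move=> qp p1; have p01 : 0 <= p <= 1 by rewrite p1 andbT; lra.
  (* The infimum is below each member of the set because the set is bounded below by 0; it remains
     to show that [p] is a member. *)
  apply: ge_inf; first by exists 0 => x [/andP[]].
  split=> // D decr muD.
  have [|s sD] := common_relabeling k0 p01 _ decr muD (d := d).
    move=> i; apply: le_lt_trans qp.
    exact: (le_bigmax _ (fun i => graph_threshold n R (d i))).
  apply/eqP/set0Pn; exists (relabel s H).
  rewrite finset.in_setI Iprop HI andbT.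
  apply/imsetP; exists [ffun i => relabel s (edges (d i))].
    by apply/ffun_onP => i; rewrite ffunE; apply: sD.
  rewrite -[H]/(edges (labeled H)) -dH relabel_bigcup.
  by apply: eq_bigr => i _; rewrite ffunE.
rewrite leNgt; apply/negP => lt_q.
(* If [q] were below the [k]-threshold, this midpoint would lie strictly between them and be at most
   1, contradicting [le_threshold]. *)
have := le_threshold ((q + Num.min (k_threshold R k I) 1) / 2).
by case: (leP (k_threshold R k I) 1) => ? le; have := le _ _; lra.
Qed.

End Copies.

Theorem theorem1p8 (R : realType) (n k : nat) (hn : (0 < n)%N) (hk : (0 < k)%N)
    (I : {set {set edge 'I_n}}) (I_nontrivial : nontrivial I)
    (I_increasing : increasing I) (I_property : graph_property I) :
  (forall H : {set edge 'I_n}, H \in I ->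
     k_threshold R k I <= r_ R k (labeled H)) /\
  k_threshold R k I <=
    minimum [set r : R | exists2 H : {set edge 'I_n},
      H \in I & r = r_ R k (labeled H)]%classic.
Proof.
have le_r H : H \in I -> k_threshold R k I <= r_ R k (labeled H).
  move=> HI; rewrite /r_.
  (* Taking [H] for every part gives one decomposition, as [k] is positive; the minimum is therefore
     attained and not a default value. *)
  have d0 : decomposition (labeled H) [ffun=> labeled H : sgraph 'I_n] (k := k).
    apply/andP; split.
      by apply/forallP=> i; rewrite ffunE /subgraph !fintype.subxx.
    apply/eqP/setP=> e; apply/bigcupP/idP => [[i _]|eH]; first by rewrite ffunE.
    by exists (Ordinal hk); rewrite ?ffunE.
  have [[d dH ->] _] := minimumP
    (fun d : {ffun 'I_k -> sgraph 'I_n} =>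
       \big[Num.max/0]_(i < k) graph_threshold n R (d i)) d0.
  exact: k_threshold_le_decomposition hk I_property HI dH.
split=> //.
(* The complete graph lies in [I], so the outer minimum is attained as well. *)
have [_ IT] := nontrivial_increasing I_nontrivial I_increasing.
have [[H HI ->] _] := minimumP (fun H : {set edge 'I_n} => r_ R k (labeled H)) IT.
exact: le_r.
Qed.
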